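(* Let $n\in\mathbb{N}$, $n\ge 1$. For $A\in\mathbb{R}^{n\times n}$, the following assertions are equivalent: (i) The semigroup $(e^{tA})_{t\ge 0}$ is eventually strongly positive. (ii) The spectral bound $s(A)$ is a dominant and geometrically simple eigenvalue of $A$, and the eigenspaces $\ker(s(A)I-A)$ and $\ker(s(A)I-A^T)$ each contain a strongly positive vector. (iii) There exists $c\in\mathbb{R}$ such that $A+cI$ is eventually strongly positive, that is, there exists $k_0>0$ such that $(A+cI)^k\gg 0$ for all $k\ge k_0$. If assertions (i)–(iii) are fulfilled, then $s(A)$ is an algebraically simple eigenvalue of $A$.
   Context: A vector is strongly positive if all its entries are $>0$; a real matrix $T$ satisfies $T\gg 0$ (is strongly positive) if $Tx$ is strongly positive for every non-zero $x$ with non-negative entries, equivalently if all entries of $T$ are $>0$. The semigroup $(e^{tA})_{t\ge0}$ is eventually strongly positive if there exists $t_0\ge 0$ such that $e^{tA}\gg 0$ for all $t\ge t_0$. $s(A)$ is the maximum of the real parts of the (complex) eigenvalues of $A$; it is dominant if $s(A)$ is an eigenvalue and is the only complex eigenvalue of $A$ with real part $s(A)$. Geometrically simple means the eigenspace is one-dimensional; algebraically simple means the generalised eigenspace is one-dimensional. *)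

(* Defs.v *)
From mathcomp Require Import all_boot all_order all_algebra.
From mathcomp Require Import all_classical all_reals all_analysis.
From mathcomp Require Import complex.

Set Implicit Arguments.
Unset Strict Implicit.
Unset Printing Implicit Defensive.

Import Order.TTheory GRing.Theory Num.Theory.
Import numFieldNormedType.Exports.
Local Open Scope classical_set_scope.
Local Open Scope ring_scope.

Definition strongly_positive_vec (R : realType) n (x : 'cV[R]_n) : Prop :=
  forall i, 0 < x i 0.

Definition strongly_positive_mx (R : realType) n (T : 'M[R]_n) : Prop :=
  forall x : 'cV[R]_n,
    (forall i, 0 <= x i 0) -> x != 0 -> strongly_positive_vec (T *m x).

Lemma strongly_positive_mxP (R : realType) n (T : 'M[R]_n) :
  strongly_positive_mx T <-> forall i j, 0 < T i j.
Proof.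
split=> [T_gt0 i j|T_gt0 x x_ge0 x_neq0 i].
  have := T_gt0 (delta_mx j 0); rewrite -colE => /(_ _ _ i).
  rewrite mxE; apply=> [k|].
    by rewrite mxE; case: (_ && _); rewrite ?ler01 ?lexx.
  apply/eqP => /matrixP/(_ j 0); rewrite !mxE !eqxx.
  by move/eqP; rewrite oner_eq0.
have [j xj] : exists j, x j 0 != 0.
  apply/existsP; apply: contraNT x_neq0 => /existsPn x0.
  by apply/eqP/matrixP => k l; rewrite ord1 mxE; apply/eqP/negPn/x0.
rewrite mxE (bigD1 j)//= ltr_pwDl ?mulr_gt0 //.
  by rewrite lt_neqAle eq_sym xj x_ge0.
by apply: sumr_ge0 => k _; rewrite mulr_ge0// ltW.
Qed.

Definition expm (R : realType) n (A : 'M[R]_n) : 'M[R]_n :=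
  limn (series (fun k => (k`!%:R : R)^-1 *: A ^+ k)).

Definition semigroup_eventually_strongly_positive
    (R : realType) n (A : 'M[R]_n) : Prop :=
  exists2 t0 : R, 0 <= t0 &
    forall t : R, t0 <= t -> strongly_positive_mx (expm (t *: A)).

Definition powers_eventually_strongly_positive
    (R : realType) n (T : 'M[R]_n) : Prop :=
  exists2 k0 : nat, (0 < k0)%N &
    forall k : nat, (k0 <= k)%N -> strongly_positive_mx (T ^+ k).

(* [eigenvalue], [eigenspace] and [geigenspace] act on row vectors, whereas
   here A acts on column vectors; hence the transposes: u belongs to the row
   space of [eigenspace A^T a] iff A *m u^T = a *: u^T. *)

Definition complex_eigenvalue (R : realType) n (A : 'M[R]_n) (z : R[i]) : bool :=
  eigenvalue (map_mx (real_complex R) A)^T z.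

(* For 0 < n this supremum is a maximum; see [spectral_bound_max]. *)
Definition spectral_bound (R : realType) n (A : 'M[R]_n) : R :=
  sup [set complex.Re z | z in [set z | complex_eigenvalue A z]].

Definition spectral_bound_dominant (R : realType) n (A : 'M[R]_n) : Prop :=
  complex_eigenvalue A (real_complex R (spectral_bound A)) /\
  forall z : R[i], complex_eigenvalue A z ->
    complex.Re z = spectral_bound A -> z = real_complex R (spectral_bound A).

Definition geometrically_simple (R : realType) n (A : 'M[R]_n) (a : R) : Prop :=
  \rank (eigenspace A^T a) = 1%N.

Definition algebraically_simple (R : realType) n (A : 'M[R]_n) (a : R) : Prop :=
  \rank (geigenspace A^T a) = 1%N.

Definition ker_has_strongly_positive (R : realType) n (B : 'M[R]_n) : Prop :=
  exists2 x : 'cV[R]_n, strongly_positive_vec x & B *m x = 0.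

Lemma spectral_bound_max (R : realType) n (A : 'M[R]_n) : (0 < n)%N ->
  (exists2 z, complex_eigenvalue A z & complex.Re z = spectral_bound A) /\
  (forall z, complex_eigenvalue A z -> complex.Re z <= spectral_bound A).
Proof.
move=> n_gt0; set B := (map_mx (real_complex R) A)^T.
have [s Ds] := closed_field_poly_normal (char_poly B).
have ev z : complex_eigenvalue A z = (z \in s).
  rewrite /complex_eigenvalue eigenvalue_root_char Ds.
  by rewrite (monicP (char_poly_monic B)) scale1r root_prod_XsubC.
have [z0 z0s] : exists z, z \in s.
  case: s Ds {ev} => [|z s _]; last by exists z; rewrite mem_head.
  rewrite big_nil => /(congr1 (fun p : {poly _} => size p)).
  rewrite (monicP (char_poly_monic B)) scale1r size_char_poly size_poly1.
  by case=> n0; rewrite n0 in n_gt0.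
have [z zs zmax] : exists2 z, z \in s &
    forall w, w \in s -> complex.Re w <= complex.Re z.
  elim: s z0 z0s {Ds ev} => // a s IHs z0 _.
  case: s IHs => [_|b s /(_ b (mem_head _ _)) [z zs zmax]].
    by exists a => [|w]; rewrite mem_seq1// => /eqP ->.
  have [az|za] := leP (complex.Re a) (complex.Re z).
    exists z; first by rewrite inE zs orbT.
    by move=> w; rewrite inE => /predU1P [->|/zmax].
  exists a; first exact: mem_head.
  move=> w; rewrite inE => /predU1P [->//|/zmax wz].
  exact: le_trans wz (ltW za).
have -> : spectral_bound A = complex.Re z.
  apply/eqP; rewrite eq_le; apply/andP; split.
    apply: ge_sup; first by exists (complex.Re z), z; rewrite //= ev.
    by move=> _ [w /= + <-]; rewrite ev => /zmax.
  apply: ub_le_sup; last by exists z; rewrite //= ev.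
  by exists (complex.Re z) => _ [w /= + <-]; rewrite ev => /zmax.
by split; [exists z; rewrite ?ev | move=> w; rewrite ev => /zmax].
Qed.

(* Main.v *)
Require Import Defs.
From mathcomp Require Import all_boot all_order all_algebra.
From mathcomp Require Import all_classical all_reals all_analysis.
From mathcomp Require Import complex ring lra.

(* Assertion (iii) is the pivot.

   (i) -> (iii): with h = t / k, the matrices (I + h A)^k and (I + h A)^(k+1)
   both tend to e^(t A) as k grows, so for one k both are strongly positive;
   since k and k + 1 are coprime, all large powers of I + h A are too.

   (iii) -> (i): for B = A + c I the coefficients of t^k in an entry of e^(t B)
   are positive from some k on, so the entry is positive for large t, and
   e^(t A) differs from e^(t B) by a positive factor.

   (iii) -> (ii): Perron's theorem for B^k yields eigenvectors x, y >> 0 of B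
   and B^T for some mu > 0, and |z| <= mu for every eigenvalue z of B; in the
   disk of radius mu only mu itself has real part mu.

   (ii) -> (iii): for large c the eigenvalue r = s(A) + c of B strictly
   dominates the others in modulus.  With the spectral projection
   P = x y^T / (y^T x), the spectral radius of B - r P is less than r, so
   B^k = (B - r P)^k + r^k P is dominated by r^k P >> 0. *)

Set Implicit Arguments.
Unset Strict Implicit.

Import Order.TTheory GRing.Theory Num.Theory.
Import numFieldNormedType.Exports.
Import ComplexField.Normc.
Local Open Scope classical_set_scope.
Local Open Scope ring_scope.

(** * Powers of a matrix and its spectral radius *)

(** The constant [K = |u 0| + c / (q - |z|)] satisfies [|z| K + c <= q K], which is exactly what the
    induction step needs. *)
Lemma perturbed_geometric_bound (C : numFieldType) (z q c : C) (u w : nat -> C) :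
    `|z| < q -> (forall k, u k.+1 = z * u k + w k) ->
    (forall k, `|w k| <= c * q ^+ k) ->
  forall k, `|u k| <= (`|u 0%N| + c / (q - `|z|)) * q ^+ k.
Proof.
move=> zq Du w_le.
have q_gt0 : 0 < q by apply: le_lt_trans zq.
have d_gt0 : 0 < q - `|z| by rewrite subr_gt0.
have c_ge0 : 0 <= c by have := le_trans (normr_ge0 _) (w_le 0%N); rewrite expr0 mulr1.
elim=> [|k IHk]; first by rewrite expr0 mulr1 lerDl divr_ge0// ltW.
set K := _ + _ in IHk *.
have cK : c <= (q - `|z|) * K.
  by rewrite mulrDr mulrCA divff ?gt_eqF// mulr1 lerDr mulr_ge0// ltW.
rewrite Du (le_trans (ler_normD _ _))// normrM.
apply: le_trans (lerD (ler_wpM2l (normr_ge0 z) IHk) (w_le k)) _.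
rewrite mulrA -mulrDl exprS mulrA ler_wpM2r ?exprn_ge0 ?(ltW q_gt0)//.
by rewrite [K * q]mulrC -lerBrDl -mulrBl.
Qed.

(* By Cayley-Hamilton, removing the factors [M - z] of the characteristic
   polynomial one at a time leaves recursions [u (k + 1) = z * u k + w k]. *)
Lemma power_mx_bound (C : numClosedFieldType) n (M : 'M[C]_n.+1) (q : C) :
    (forall z, eigenvalue M z -> `|z| < q) ->
  exists K : 'M[C]_n.+1, forall k i j, `|(M ^+ k) i j| <= K i j * q ^+ k.
Proof.
have [s Ds] := closed_field_poly_normal (char_poly M).
rewrite (monicP (char_poly_monic M)) scale1r in Ds.
move=> Mq; have {Mq} sq : {in s, forall z, `|z| < q}.
  by move=> z zs; apply: Mq; rewrite eigenvalue_root_char Ds root_prod_XsubC.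
(* The right factor [N] drives the induction over the roots: each factor [M - z] is moved into [N].
   Cayley-Hamilton supplies the case [N = 1]. *)
suff: forall N : 'M[C]_n.+1, horner_mx M (\prod_(z <- s) ('X - z%:P)) *m N = 0 ->
    exists K : 'M[C]_n.+1, forall k i j, `|(M ^+ k *m N) i j| <= K i j * q ^+ k.
  move=> /(_ 1%:M); rewrite mulmx1 -Ds Cayley_Hamilton => /(_ erefl) [K KM].
  by exists K => k i j; have := KM k i j; rewrite mulmx1.
elim: s sq {Ds} => [_ N|z s IHs sq N].
  rewrite big_nil rmorph1 mul1mx => ->; exists 0 => k i j.
  by rewrite mulmx0 !mxE normr0 mul0r.
rewrite big_cons mulrC rmorphM /= rmorphB /= horner_mx_X horner_mx_C -mulmxE -mulmxA.
move=> Mz0; have [|K KM] := IHs _ _ Mz0.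
  by move=> w ws; apply: sq; rewrite inE ws orbT.
have zq : `|z| < q by apply: sq; rewrite mem_head.
exists (\matrix_(i, j) (`|N i j| + K i j / (q - `|z|))) => k i j.
have Du m : (M ^+ m.+1 *m N) i j =
    z * (M ^+ m *m N) i j + (M ^+ m *m ((M - z%:M) *m N)) i j.
  rewrite exprSr -mulmxE mulmxBl mul_scalar_mx mulmxBr -scalemxAr mulmxA.
  by rewrite !mxE [RHS]addrC subrK.
have /(_ k) := @perturbed_geometric_bound _ z q (K i j) _ _ zq Du (fun m => KM m i j).
rewrite /= expr0 mul1mx => Hk; rewrite (mxE _ _ i j). exact: Hk.
Qed.

Lemma geom_dominated (R : realType) (K b q r : R) : 0 <= q -> q < r -> 0 < b ->
  exists N, forall k, (N <= k)%N -> K * q ^+ k < b * r ^+ k.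
Proof.
move=> q0 qr b0; have r0 : 0 < r by apply: le_lt_trans qr.
have qr1 : `|q / r| < 1 by rewrite ger0_norm ?divr_ge0 ?(ltW r0)// ltr_pdivrMr ?mul1r.
have /cvgr_lt/(_ b b0) [N _ HN] := @cvg_geometric R K (q / r) qr1.
exists N => k Nk; have := HN k Nk; rewrite /geometric /= expr_div_n mulrA.
by rewrite ltr_pdivrMr// exprn_gt0.
Qed.

Lemma complex_eigenvalueP (R : realType) n (A : 'M[R]_n) (z : R[i]) :
  reflect (exists2 v : 'cV[R[i]]_n, map_mx (real_complex R) A *m v = z *: v & v != 0)
          (complex_eigenvalue A z).
Proof.
rewrite /complex_eigenvalue.
apply: (iffP eigenvalueP) => -[v vz v0]; exists v^T; rewrite ?trmx_eq0//.
  by apply: trmx_inj; rewrite trmx_mul linearZ /= !trmxK.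
by rewrite -trmx_mul vz linearZ.
Qed.

Lemma normcE (R : rcfType) (z : R[i]) : `|z| = real_complex R (normc z).
Proof. by []. Qed.

Lemma normc_ge0 (R : rcfType) (z : R[i]) : 0 <= normc z.
Proof. by rewrite -ler0c -normcE. Qed.

Lemma normc_real_complex (R : rcfType) (x : R) : normc (real_complex R x) = `|x|.
Proof. by rewrite /normc /= expr0n addr0 sqrtr_sqr. Qed.

Lemma normc_sum (R : rcfType) (I : finType) (F : I -> R[i]) :
  normc (\sum_i F i) <= \sum_i normc (F i).
Proof.
rewrite -lecR rmorph_sum /= -normcE.
exact: ler_norm_sum.
Qed.

Lemma char_poly_trmx (F : comNzRingType) n (A : 'M[F]_n) :
  char_poly A^T = char_poly A.
Proof.
by rewrite /char_poly -[RHS]det_tr /char_poly_mx linearB /= tr_scalar_mx map_trmx.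
Qed.

Lemma real_power_mx_bound (R : realType) n (M : 'M[R]_n.+1) (q : R) :
    (forall z, complex_eigenvalue M z -> normc z < q) ->
  exists K : 'M[R]_n.+1, forall k i j, `|(M ^+ k) i j| <= K i j * q ^+ k.
Proof.
move=> Mq; have [|K KM] :=
  @power_mx_bound _ n (map_mx (real_complex R) M) (real_complex R q).
  move=> z; rewrite eigenvalue_root_char -char_poly_trmx -eigenvalue_root_char => /Mq.
  by rewrite normcE ltcR.
(* An inequality in [R[i]] forces equal imaginary parts and compares the real ones, so the real part
   of the bound suffices. *)
exists (map_mx (fun z => complex.Re z) K) => k i j.
have := KM k i j.
rewrite -rmorphXn mxE normcE normc_real_complex -rmorphXn lecE => /andP[_] /=.
by rewrite mxE; case: (K i j) => a b /=; rewrite mulr0 subr0.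
Qed.

Lemma seq_argmax (R : realDomainType) (T : eqType) (f : T -> R) (s : seq T) x0 :
  x0 \in s -> exists2 x, x \in s & {in s, forall y, f y <= f x}.
Proof.
elim: s x0 => // a s IHs x0 _; case: s IHs => [_|b s /(_ b (mem_head _ _)) [x xs xmax]].
  by exists a => [|w]; rewrite mem_seq1// => /eqP ->.
have [ax|xa] := leP (f a) (f x).
  by exists x => [|y]; rewrite inE ?xs ?orbT// => /predU1P [->|/xmax].
exists a => [|y]; first exact: mem_head.
by rewrite inE => /predU1P [->//|/xmax yx]; apply: le_trans yx (ltW xa).
Qed.

Lemma complex_eigenvalue_seq (R : realType) n (A : 'M[R]_n) : (0 < n)%N ->
  exists s : seq R[i], s != [::] /\ forall z, complex_eigenvalue A z = (z \in s).
Proof.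
move=> n_gt0; set B := (map_mx (real_complex R) A)^T.
have [s Ds] := closed_field_poly_normal (char_poly B).
rewrite (monicP (char_poly_monic B)) scale1r in Ds.
exists s; split.
  apply: contraTneq n_gt0 => s0; have := size_char_poly B.
  by rewrite Ds s0 big_nil size_poly1 => -[<-].
move=> z; rewrite /complex_eigenvalue eigenvalue_root_char Ds root_prod_XsubC//.
Qed.

(** * Perron's theorem *)

Lemma mulmx_col_gt0 (R : realDomainType) m n (T : 'M[R]_(m, n)) (x : 'cV[R]_n) :
    (forall i j, 0 < T i j) -> (forall i, 0 <= x i 0) -> x != 0 ->
  forall i, 0 < (T *m x) i 0.
Proof.
move=> T_gt0 x_ge0 /cV0Pn [j xj] i.
rewrite mxE (bigD1 j) //= ltr_pwDl//.
  by rewrite mulr_gt0// lt_neqAle eq_sym xj x_ge0.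
by apply: sumr_ge0 => k _; rewrite mulr_ge0// ltW.
Qed.

Lemma ler_mulmx_col (R : numDomainType) m n (T : 'M[R]_(m, n)) (x y : 'cV[R]_n) :
    (forall i j, 0 <= T i j) -> (forall i, x i 0 <= y i 0) ->
  forall i, (T *m x) i 0 <= (T *m y) i 0.
Proof.
by move=> T_ge0 xy i; rewrite !mxE ler_sum// => j _; rewrite ler_wpM2l.
Qed.

Lemma expr_le_subeigenvector (R : numDomainType) n (T : 'M[R]_n) (x : 'cV[R]_n) q :
    (forall i j, 0 <= T i j) -> 0 <= q ->
    (forall i, q * x i 0 <= (T *m x) i 0) ->
  forall k i, q ^+ k * x i 0 <= (T ^+ k *m x) i 0.
Proof.
move=> T_ge0 q_ge0 qx; elim=> [|k IHk] i; first by rewrite expr0 mul1r mul1mx.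
rewrite [T ^+ _]exprS -mulmxE -mulmxA.
apply: le_trans (@ler_mulmx_col _ _ _ _ (q ^+ k *: x) _ T_ge0 _ i).
  by rewrite -scalemxAr mxE exprSr -mulrA ler_wpM2l ?exprn_ge0.
by move=> j; rewrite mxE.
Qed.

(** This is the entrywise triangle inequality for [T v = z v]. *)
Lemma normc_eigenvector_le (R : realType) n (T : 'M[R]_n) (z : R[i]) (v : 'cV[R[i]]_n) :
    (forall i j, 0 <= T i j) ->
    map_mx (real_complex R) T *m v = z *: v ->
  forall i, normc z * map_mx (@normc R) v i 0 <= (T *m map_mx (@normc R) v) i 0.
Proof.
move=> T_ge0 vz i; rewrite mxE -normcM.
have -> : z * v i 0 = (z *: v) i 0 by rewrite mxE.
rewrite -vz !mxE (le_trans (normc_sum _))// ler_sum// => j _.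
by rewrite !mxE normcM normc_real_complex ger0_norm.
Qed.

Lemma map_normc_eq0 (R : realType) n (v : 'cV[R[i]]_n) :
  (map_mx (@normc R) v == 0) = (v == 0).
Proof.
apply/eqP/eqP => [/matrixP v0|->]; apply/matrixP => i j.
  by rewrite [RHS]mxE; apply: eq0_normc; have := v0 i j; rewrite !mxE.
by rewrite !mxE normc0.
Qed.

Lemma map_normc_ge0 (R : realType) n (v : 'cV[R[i]]_n) i :
  0 <= map_mx (@normc R) v i 0.
Proof. by rewrite mxE normc_ge0. Qed.

Lemma col_subZ_ge0 (R : numDomainType) n (x u : 'cV[R]_n) a i :
  (0 <= (u - a *: x) i 0) = (a * x i 0 <= u i 0).
Proof. by rewrite !mxE subr_ge0. Qed.

(** The ratio at [i0] is the largest [a] with [a x <= u], and [u - a x] then vanishes at [i0]. *)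
Lemma positive_ratio_min (R : realFieldType) n (x u : 'cV[R]_n.+1) :
    (forall i, 0 < x i 0) ->
  exists i0, forall i, u i0 0 / x i0 0 * x i 0 <= u i 0.
Proof.
move=> x_gt0; pose f i := u i 0 / x i 0.
have [i0 _ fmin] := @arg_minP _ R _ ord0 predT f isT.
by exists i0 => i; rewrite -ler_pdivlMr//; apply: fmin.
Qed.

(* Let [a] be the entrywise modulus of an eigenvector for an eigenvalue of
   maximal modulus [rho].  Then [rho a <= T a]; were this not an equality,
   [w = T a] would satisfy [(rho + e) w <= T w] for some [e > 0], so that the
   powers of [T] would grow faster than [(rho + e / 2) ^ k]. *)
Lemma perron (R : realType) n (T : 'M[R]_n.+1) : (forall i j, 0 < T i j) ->
  exists2 x : 'cV[R]_n.+1, strongly_positive_vec x & exists rho, T *m x = rho *: x.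
Proof.
move=> T_gt0; have T_ge0 i j : 0 <= T i j by rewrite ltW.
have [s [s0 evs]] := @complex_eigenvalue_seq _ _ T (ltn0Sn n).
have [z zs zmax] : exists2 z, z \in s & {in s, forall w, normc w <= normc z}.
  by case: s s0 {evs} => // a s _; apply: seq_argmax (mem_head a s).
have := zs; rewrite -evs => /complex_eigenvalueP [v vz v0].
set a := map_mx (@normc R) v; set rho := normc z in zmax *.
have a_ge0 i : 0 <= a i 0 by exact: map_normc_ge0.
have a0 : a != 0 by rewrite map_normc_eq0.
have Ta := mulmx_col_gt0 T_gt0 a_ge0 a0.
have rho_ge0 : 0 <= rho by exact: normc_ge0.
have a_le : forall i, rho * a i 0 <= (T *m a) i 0 := normc_eigenvector_le T_ge0 vz.
have [Da|d0] := eqVneq (T *m a - rho *: a) 0.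
  exists a; last by exists rho; apply/eqP; rewrite -subr_eq0 Da.
  move=> i; have := Ta i; move/eqP: Da; rewrite subr_eq0 => /eqP ->.
  rewrite [(rho *: a) i 0]mxE [X in _ -> is_true X]lt_neqAle a_ge0 andbT.
  by apply: contraTneq => <-; rewrite mulr0 ltxx.
have d_ge0 i : 0 <= (T *m a - rho *: a) i 0  by rewrite col_subZ_ge0.
(* [d] equals [T w - rho w]; it is strictly positive because [T] is applied to the nonzero
   nonnegative defect [T a - rho a]. *)
have := mulmx_col_gt0 T_gt0 d_ge0 d0; set w := T *m a in Ta *; set d := T *m _ => d_gt0.
have [i0 wmin] := @positive_ratio_min _ _ w d Ta.
set e := d i0 0 / w i0 0 in wmin; have e_gt0 : 0 < e by rewrite divr_gt0.
(* The rate [rho + e / 2] exceeds every eigenvalue modulus but stays below the growth rate [rho + e]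
   forced on [T ^+ k *m w]. *)
have [|K KT] := @real_power_mx_bound _ _ T (rho + e / 2).
  move=> y; rewrite evs => /zmax/le_lt_trans; apply.
  by rewrite ltrDl divr_gt0.
have wT k : (rho + e) ^+ k * w 0 0 <= (T ^+ k *m w) 0 0.
  apply: expr_le_subeigenvector => // [|i]; first by rewrite addr_ge0// ltW.
  have Dd : d i 0 = (T *m w) i 0 - rho * w i 0.
    by rewrite /d mulmxBr -scalemxAr -/w !mxE.
  by have := wmin i; rewrite Dd mulrDl lerBrDl.
have [N /(_ N (leqnn N))] := @geom_dominated _ (\sum_j K 0 j * w j 0) (w 0 0)
  (rho + e / 2) (rho + e) ltac:(lra) ltac:(lra) (Ta 0).
rewrite ltNge => /negP []; rewrite mulrC (le_trans (wT N))//.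
rewrite mxE mulr_suml ler_sum// => j _.
rewrite mulrAC ler_wpM2r ?(ltW (Ta j))//; exact: le_trans (ler_norm _) (KT _ _ _).
Qed.

(** Subtract from [u] the largest multiple of [x] below it. The remainder is nonnegative and
    vanishes at [i0]; were it nonzero, [T] would make its entry at [i0] positive, although that
    entry is only multiplied by [rho]. *)
Lemma positive_mx_eigenvector_unique (R : realFieldType) n (T : 'M[R]_n.+1) rho
    (x u : 'cV[R]_n.+1) :
    (forall i j, 0 < T i j) -> (forall i, 0 < x i 0) ->
    T *m x = rho *: x -> T *m u = rho *: u ->
  exists a, u = a *: x.
Proof.
move=> T_gt0 x_gt0 Tx Tu; have [i0] := @positive_ratio_min _ _ x u x_gt0.
set a := u i0 0 / _ => a_le; exists a; apply/eqP; rewrite -subr_eq0.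
apply/negP => /negP w0.
have w_ge0 i : 0 <= (u - a *: x) i 0 by rewrite !mxE subr_ge0.
have := mulmx_col_gt0 T_gt0 w_ge0 w0 i0.
rewrite mulmxBr -scalemxAr Tx Tu !mxE /a mulrCA divfK ?gt_eqF//.
by rewrite subrr ltxx.
Qed.

(** Pairing [|z| |v| <= T |v|] with [y] gives [|z| (y . |v|) <= rho (y . |v|)], and [y . |v|] is
    positive. *)
Lemma normc_eigenvalue_le (R : realType) n (T : 'M[R]_n) (y : 'cV[R]_n) rho (z : R[i]) :
    (forall i j, 0 <= T i j) -> strongly_positive_vec y -> y^T *m T = rho *: y^T ->
  complex_eigenvalue T z -> normc z <= rho.
Proof.
move=> T_ge0 y_gt0 yT /complex_eigenvalueP [v vz v0].
set a := map_mx (@normc R) v.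
have yt_gt0 i j : 0 < y^T i j by rewrite (ord1 i) mxE.
have a0 : a != 0 by rewrite map_normc_eq0.
have ya := mulmx_col_gt0 yt_gt0 (@map_normc_ge0 _ _ v) a0 0.
rewrite -(ler_pM2r ya).
have za_le i : (normc z *: a) i 0 <= (T *m a) i 0.
  by rewrite mxE; apply: normc_eigenvector_le.
have := ler_mulmx_col (fun i j => ltW (yt_gt0 i j)) za_le 0.
by rewrite mulmxA yT -scalemxAr -scalemxAl [leLHS]mxE [leRHS]mxE.
Qed.

(** * Eventually positive powers and dominant eigenvalues *)

Lemma exp_mx_eigenvector (R : comNzRingType) n (A : 'M[R]_n) (v : 'cV[R]_n) a k :
  A *m v = a *: v -> A ^+ k *m v = a ^+ k *: v.
Proof.
move=> Av; elim: k => [|k IHk]; first by rewrite !expr0 mul1mx scale1r.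
by rewrite !exprS -mulmxE -mulmxA IHk -scalemxAr Av scalerA mulrC.
Qed.

Lemma trmx_exp (R : comNzRingType) n (A : 'M[R]_n) k : (A ^+ k)^T = A^T ^+ k.
Proof.
elim: k => [|k IHk]; first by rewrite !expr0 trmx1.
by rewrite exprSr exprS -IHk -mulmxE trmx_mul.
Qed.

Lemma eigenspace_rank1P (F : fieldType) n (A : 'M[F]_n) a (x : 'cV[F]_n) :
    x != 0 -> A *m x = a *: x ->
  \rank (eigenspace A^T a) = 1%N <->
  (forall u : 'cV[F]_n, A *m u = a *: u -> exists b, u = b *: x).
Proof.
move=> x0 Ax; have col_eigen (u : 'cV[F]_n) :
    A *m u = a *: u -> (u^T <= eigenspace A^T a)%MS.
  by move=> Au; apply/eigenspaceP; rewrite -trmx_mul Au linearZ.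
have rx : \rank x^T = 1%N by rewrite rank_rV trmx_eq0 x0.
have x_sub := col_eigen _ Ax; split=> [r1 u Au|x_span].
  have := (mxrank_leqif_sup x_sub).2; rewrite rx r1 eqxx => /esym sub_x.
  have /sub_rVP [b ub] := submx_trans (col_eigen _ Au) sub_x.
  by exists b; apply: trmx_inj; rewrite ub linearZ.
rewrite -rx; apply/eqP; rewrite eq_sym (mxrank_leqif_sup x_sub).2.
apply/rV_subP => w /eigenspaceP wa; apply/sub_rVP.
have [|b wb] := x_span w^T; last first.
  by exists b; apply: trmx_inj; rewrite wb linearZ /= trmxK.
by apply: trmx_inj; rewrite trmx_mul !trmxK wa linearZ /= trmxK.
Qed.

(** A Jordan chain of length two would put [x] in the range of [A - a], which [y] annihilates,
    against [x . y != 0]. *)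
Lemma geigenspace_sub_eigenspace (F : fieldType) n (A : 'M[F]_n.+1) a
    (x y : 'cV[F]_n.+1) :
    (forall u : 'cV[F]_n.+1, A *m u = a *: u -> exists b, u = b *: x) ->
    A^T *m y = a *: y -> (x^T *m y) 0 0 != 0 ->
  (geigenspace A^T a <= eigenspace A^T a)%MS.
Proof.
move=> x_span Ay xy0; set G := A^T - a%:M.
have Gy : G *m y = 0 by rewrite mulmxBl Ay mul_scalar_mx subrr.
rewrite geigenspaceE; apply/rV_subP => w; rewrite sub_kermx -/G => wG.
rewrite sub_kermx -/G; apply/eqP.
(* Descent on the exponent: the last nonzero candidate [w G ^+ m.+1] is some [b x^T], and pairing it
   with [y] forces [b = 0]. *)
suff H m : w *m G ^+ m = 0 -> w *m G = 0 by apply: H (eqP wG).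
elim: m => [|[|m] IHm wG0].
- by rewrite expr0 mulmx1 => ->; rewrite mul0mx.
- by rewrite expr1 in wG0.
apply: IHm; move: wG0; rewrite exprSr -mulmxE mulmxA => wG0.
have [|b wb] := x_span (w *m G ^+ m.+1)^T.
  apply: trmx_inj; rewrite trmx_mul trmxK linearZ /= trmxK.
  by move/eqP: wG0; rewrite /G mulmxBr mul_mx_scalar subr_eq0 => /eqP.
have {}wb : w *m G ^+ m.+1 = b *: x^T by apply: trmx_inj; rewrite wb linearZ /= trmxK.
have : (w *m G ^+ m.+1 *m y) 0 0 = 0.
  by rewrite exprSr -mulmxE mulmxA -!mulmxA Gy !mulmx0 mxE.
rewrite wb -scalemxAl mxE => /eqP; rewrite mulf_eq0 (negPf xy0) orbF => /eqP ->.
by rewrite scale0r.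
Qed.

(** [B] commutes with the positive matrix [B ^+ k0], whose Perron vector [x] is unique up to
    scaling, so [B x] is a multiple of [x]. Uniqueness is inherited as well, since eigenvectors of
    [B] for [mu] are eigenvectors of [B ^+ k0] for [mu ^+ k0]. *)
Lemma eventually_positive_eigenvector (R : realType) n (B : 'M[R]_n.+1) :
    powers_eventually_strongly_positive B ->
  exists2 x : 'cV[R]_n.+1, strongly_positive_vec x &
    exists mu, [/\ 0 < mu, B *m x = mu *: x &
      forall u : 'cV[R]_n.+1, B *m u = mu *: u -> exists b, u = b *: x].
Proof.
move=> [k0 k0_gt0 B_gt0]; have T_gt0 := (strongly_positive_mxP _).1 (B_gt0 k0 (leqnn _)).
have [x x_gt0 [rho Tx]] := perron T_gt0; exists x => //.
have [|mu Bx] := positive_mx_eigenvector_unique (u := B *m x) T_gt0 x_gt0 Tx.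
  rewrite mulmxA mulmxE -exprSr exprS -mulmxE -mulmxA Tx.
  by rewrite scalemxAr.
have x_neq0 : x != 0.
  by apply/eqP => x0; have := x_gt0 0; rewrite x0 mxE ltxx.
have mu_gt0 k : (k0 <= k)%N -> 0 < mu ^+ k.
  move=> /B_gt0/strongly_positive_mxP Bk.
  have := mulmx_col_gt0 Bk (fun i => ltW (x_gt0 i)) x_neq0 0.
  by rewrite (exp_mx_eigenvector _ Bx) mxE pmulr_lgt0.
exists mu; split=> // [|u Bu].
  (* Two consecutive positive powers of [mu] exclude a negative [mu]. *)
  by have := mu_gt0 k0.+1 (leqnSn _); rewrite exprS pmulr_lgt0// mu_gt0.
exact: positive_mx_eigenvector_unique T_gt0 x_gt0 (exp_mx_eigenvector _ Bx)
  (exp_mx_eigenvector _ Bu).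
Qed.

(** [z ^+ k0] is an eigenvalue of the positive matrix [B ^+ k0], so its modulus is at most
    [mu ^+ k0]; then take roots. *)
Lemma eventually_positive_spectral_radius (R : realType) n (B : 'M[R]_n.+1) mu
    (y : 'cV[R]_n.+1) (z : R[i]) :
    powers_eventually_strongly_positive B -> 0 < mu ->
    strongly_positive_vec y -> B^T *m y = mu *: y ->
  complex_eigenvalue B z -> normc z <= mu.
Proof.
move=> [k0 k0_gt0 B_gt0] mu_gt0 y_gt0 By /complex_eigenvalueP [v vz v0].
have T_gt0 := (strongly_positive_mxP _).1 (B_gt0 k0 (leqnn _)).
have /normc_eigenvalue_le := fun i j => ltW (T_gt0 i j).
move=> /(_ y (mu ^+ k0) (z ^+ k0) y_gt0).
have -> : normc (z ^+ k0) = normc z ^+ k0.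
  by apply: complexI; rewrite [RHS]rmorphXn; exact: (normrX k0 z).
rewrite ler_pXn2r ?nnegrE ?normc_ge0 ?(ltW mu_gt0)//; apply.
  apply: trmx_inj; rewrite trmx_mul trmxK trmx_exp.
  by rewrite (exp_mx_eigenvector _ By) linearZ /= trmxK.
apply/complex_eigenvalueP; exists v => //.
by rewrite rmorphXn /= (exp_mx_eigenvector _ vz).
Qed.

Lemma complex_eigenvalue_shift (R : realType) n (A : 'M[R]_n) c (z : R[i]) :
  complex_eigenvalue A z -> complex_eigenvalue (A + c%:M) (z + real_complex R c).
Proof.
move=> /complex_eigenvalueP [v vz v0]; apply/complex_eigenvalueP; exists v => //.
by rewrite map_mxD map_scalar_mx mulmxDl vz mul_scalar_mx scalerDl.
Qed.

Lemma complex_eigenvalue_real (R : realType) n (A : 'M[R]_n) a (x : 'cV[R]_n) :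
  x != 0 -> A *m x = a *: x -> complex_eigenvalue A (real_complex R a).
Proof.
move=> x0 Ax; apply/complex_eigenvalueP; exists (map_mx (real_complex R) x).
  by rewrite -map_mxM Ax map_mxZ.
by rewrite map_mx_eq0.
Qed.

Lemma spectral_boundE (R : realType) n (A : 'M[R]_n) s : (0 < n)%N ->
    complex_eigenvalue A (real_complex R s) ->
    (forall z, complex_eigenvalue A z -> complex.Re z <= s) ->
  spectral_bound A = s.
Proof.
move=> /spectral_bound_max-/(_ _ A) [[z zA <-] ub] sA s_ub.
by apply/eqP; rewrite eq_le s_ub//=; exact: ub _ sA.
Qed.

Lemma Re_le_normc (R : rcfType) (z : R[i]) : complex.Re z <= normc z.
Proof.
case: z => a b /=; apply: le_trans (ler_norm _) _.
by rewrite -sqrtr_sqr ler_wsqrtr// lerDl sqr_ge0.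
Qed.

Lemma strongly_positive_neq0 (R : realType) n (x : 'cV[R]_n.+1) :
  strongly_positive_vec x -> x != 0.
Proof. by move=> /(_ 0); apply: contraTneq => ->; rewrite mxE ltxx. Qed.

Lemma dot_gt0 (R : realType) n (x y : 'cV[R]_n.+1) :
  strongly_positive_vec x -> strongly_positive_vec y -> 0 < (x^T *m y) 0 0.
Proof.
move=> x_gt0 y_gt0; apply: (@mulmx_col_gt0 _ _ _ x^T).
- by move=> i j; rewrite (ord1 i) mxE.
- by move=> i; rewrite ltW.
- exact: strongly_positive_neq0.
Qed.

Lemma sub_scalar_kerP (R : nzRingType) n (A : 'M[R]_n) a (x : 'cV[R]_n) :
  (a%:M - A) *m x = 0 <-> A *m x = a *: x.
Proof.
rewrite mulmxBl mul_scalar_mx; split=> [/eqP|->]; last by rewrite subrr.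
by rewrite subr_eq0 => /eqP.
Qed.

Lemma Im0_normc_le_Re (R : rcfType) (z : R[i]) :
  normc z <= complex.Re z -> complex.Im z = 0.
Proof.
case: z => a b /= ab; have a_ge0 := le_trans (sqrtr_ge0 _) ab.
move: ab; rewrite -ler_sqr ?nnegrE ?sqrtr_ge0// sqr_sqrtr ?addr_ge0 ?sqr_ge0//.
by rewrite gerDl => b2; apply/eqP; rewrite -sqrf_eq0 eq_le b2 sqr_ge0.
Qed.

Lemma powers_positive_dominant (R : realType) n (A : 'M[R]_n.+1) c :
    powers_eventually_strongly_positive (A + c%:M) ->
  [/\ spectral_bound_dominant A,
      geometrically_simple A (spectral_bound A),
      ker_has_strongly_positive ((spectral_bound A)%:M - A) &
      ker_has_strongly_positive ((spectral_bound A)%:M - A^T)].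
Proof.
move=> B_pos; set B := A + c%:M in B_pos.
have [x x_gt0 [mu [mu_gt0 Bx x_span]]] := eventually_positive_eigenvector B_pos.
have Bt_pos : powers_eventually_strongly_positive B^T.
  have [k0 k0_gt0 Bk] := B_pos; exists k0 => // k /Bk/strongly_positive_mxP Bk_gt0.
  by apply/strongly_positive_mxP => i j; rewrite -trmx_exp mxE.
have [y y_gt0 [nu [_ By _]]] := eventually_positive_eigenvector Bt_pos.
(* Evaluating [y^T B x] in two ways gives [nu (y . x) = mu (y . x)] with [y . x > 0]. *)
have Dnu : nu = mu.
  have : (B^T *m y)^T *m x = y^T *m (B *m x) by rewrite trmx_mul trmxK mulmxA.
  rewrite By Bx linearZ /= -scalemxAl -scalemxAr => /matrixP/(_ 0 0); rewrite !mxE.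
  by apply: mulIf; have := dot_gt0 y_gt0 x_gt0; rewrite mxE => /gt_eqF ->.
rewrite {}Dnu in By.
have eigenA (M : 'M[R]_n.+1) (u : 'cV[R]_n.+1) :
    (M + c%:M) *m u = mu *: u <-> M *m u = (mu - c) *: u.
  rewrite mulmxDl mul_scalar_mx scalerBl; split=> [<-|->]; first by rewrite addrK.
  by rewrite subrK.
have Ax := (eigenA _ _).1 Bx.
have Ay : A^T *m y = (mu - c) *: y.
  by apply/eigenA; rewrite -By /B linearD /= tr_scalar_mx.
have x0 := strongly_positive_neq0 x_gt0.
have A_le z : complex_eigenvalue A z -> normc (z + real_complex R c) <= mu.
  by move=> /(complex_eigenvalue_shift c); apply: eventually_positive_spectral_radius By.
have Re_shift (z : R[i]) : complex.Re (z + real_complex R c) = complex.Re z + c.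
  by case: z => a b /=.
have As := complex_eigenvalue_real x0 Ax.
have Ds : spectral_bound A = mu - c.
  apply: spectral_boundE => // z /A_le; rewrite lerBrDr; apply: le_trans.
  by rewrite -Re_shift Re_le_normc.
split; rewrite ?/spectral_bound_dominant Ds.
(* [z + c] has real part [mu] and modulus at most [mu], hence is real. *)
- split=> // z /A_le zc Rz; apply/eqP; rewrite eq_complex /= Rz eqxx /=.
  have : complex.Im (z + real_complex R c) = 0.
    by apply: Im0_normc_le_Re; rewrite Re_shift Rz subrK.
  by case: {zc Rz} z => a b /=; rewrite addr0 => ->.
- apply/(eigenspace_rank1P x0 Ax) => u /eigenA; exact: x_span.
- by exists x => //; apply/sub_scalar_kerP.
- by exists y => //; apply/sub_scalar_kerP.
Qed.

(** * Spectral projection, and shifts that make an eigenvalue dominant in modulus *)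

(** As [B] and [r] are real, the real and imaginary parts of [v] satisfy the eigenvector equation
    separately. *)
Lemma ker_mulmx_Re_Im (R : realType) n (B : 'M[R]_n) r (x : 'cV[R]_n)
    (v : 'cV[R[i]]_n) :
    (forall u : 'cV[R]_n, B *m u = r *: u -> exists b, u = b *: x) ->
    map_mx (real_complex R) B *m v = real_complex R r *: v ->
  exists b, v = b *: map_mx (real_complex R) x.
Proof.
move=> x_span Bv.
have part (f : R[i] -> R) (fD : {morph f : a b / a + b}) (f0 : f 0 = 0)
    (fZ : forall a z, f (real_complex R a * z) = a * f z) :
    exists b, map_mx f v = b *: x.
  apply: x_span; apply/matrixP => i j.
  have /matrixP/(_ i j)/(congr1 f) := Bv; rewrite !mxE fZ (big_morph f fD f0) => <-.
  by apply: eq_bigr => k _; rewrite !mxE fZ.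
have [|//||a Ra] := part (fun z => complex.Re z).
- by move=> [? ?] [? ?].
- by move=> a [b d] /=; rewrite mul0r subr0.
have [|//||b Ib] := part (fun z => complex.Im z).
- by move=> [? ?] [? ?].
- by move=> p [q d] /=; rewrite mul0r addr0.
exists (Complex a b); apply/matrixP => i j.
have /matrixP/(_ i j) := Ra; have /matrixP/(_ i j) := Ib.
rewrite !mxE /=; case: (v i j) => p q /= -> ->.
by apply/eqP; rewrite eq_complex /= !mulr0 subr0 add0r !eqxx.
Qed.

(** With [M = B - r P] both [M P] and [P M] vanish, so no cross terms survive. At exponent 0 the
    identity would read [1 = 1 + P], hence the successors. *)
Lemma exp_mx_split_projection (R : comNzRingType) n (B P : 'M[R]_n) r :
    B *m P = r *: P -> P *m B = r *: P -> P *m P = P ->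
  forall k, B ^+ k.+1 = (B - r *: P) ^+ k.+1 + r ^+ k.+1 *: P.
Proof.
move=> BP PB PP; have [M DM] : exists M, M = B - r *: P by exists (B - r *: P).
have DB : B = M + r *: P by rewrite DM subrK.
have MP : M *m P = 0 by rewrite DM mulmxBl BP -scalemxAl PP subrr.
have PM : P *m M = 0 by rewrite DM mulmxBr PB -scalemxAr PP subrr.
rewrite -DM; elim=> [|k IHk]; first by rewrite !expr1.
rewrite exprS IHk -mulmxE {1}DB mulmxDl !mulmxDr -!scalemxAl -!scalemxAr MP PP.
rewrite [X in P *m X]exprS -mulmxE mulmxA PM mul0mx !scaler0 add0r addr0.
by rewrite [M ^+ k.+2]exprS [r ^+ k.+2]exprS scalerA.
Qed.

Lemma eventually_positive_of_dominant (R : realType) n (B : 'M[R]_n.+1) r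
    (x y : 'cV[R]_n.+1) :
    0 < r -> strongly_positive_vec x -> strongly_positive_vec y ->
    B *m x = r *: x -> B^T *m y = r *: y ->
    (forall u : 'cV[R]_n.+1, B *m u = r *: u -> exists b, u = b *: x) ->
    (forall z, complex_eigenvalue B z -> z != real_complex R r -> normc z < r) ->
  powers_eventually_strongly_positive B.
Proof.
move=> r_gt0 x_gt0 y_gt0 Bx By x_span B_lt.
set d := (y^T *m x) 0 0; have d_gt0 : 0 < d by exact: dot_gt0.
have yx : y^T *m x = d%:M by apply/matrixP => i j; rewrite !ord1 [RHS]mxE eqxx mulr1n.
have yB : y^T *m B = r *: y^T.
  by apply: trmx_inj; rewrite trmx_mul trmxK By linearZ /= trmxK.
pose P := d^-1 *: (x *m y^T); pose M := B - r *: P.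
have yP : y^T *m P = y^T.
  by rewrite /P -scalemxAr mulmxA yx mul_scalar_mx scalerA mulVf ?gt_eqF// scale1r.
have yM : y^T *m M = 0 by rewrite mulmxBr yB -scalemxAr yP subrr.
have PP : P *m P = P by rewrite {1}/P -scalemxAl -mulmxA yP.
have BP : B *m P = r *: P by rewrite /P -scalemxAr mulmxA Bx -scalemxAl !scalerA mulrC.
have PB : P *m B = r *: P.
  by rewrite /P -scalemxAl -mulmxA yB -!scalemxAr !scalerA mulrC.
have DBk := exp_mx_split_projection BP PB PP; rewrite -/M in DBk.
(* Since [y^T M = 0], either [z = 0] or [y^T v = 0]. In the latter case [P v = 0], so [v] is an
   eigenvector of [B] for [z]; and [z = r] would make [v] a multiple of [x], against [y . x > 0]. *)
have M_lt z : complex_eigenvalue M z -> normc z < r.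
  move=> /complex_eigenvalueP [v vz v0].
  have zyv : z *: (map_mx (real_complex R) y^T *m v) = 0.
    by rewrite scalemxAr -vz mulmxA -map_mxM yM map_mx0 mul0mx.
  move/eqP: zyv; rewrite scaler_eq0 => /orP [/eqP ->|/eqP yv]; first by rewrite normc0.
  have Pv : map_mx (real_complex R) P *m v = 0.
    by rewrite map_mxZ map_mxM -scalemxAl -mulmxA yv mulmx0 scaler0.
  have Bv : map_mx (real_complex R) B *m v = z *: v.
    by rewrite -vz map_mxB mulmxBl map_mxZ -scalemxAl Pv scaler0 subr0.
  apply: B_lt; first by apply/complex_eigenvalueP; exists v.
  apply: contra v0 => /eqP zr; rewrite zr in Bv.
  have [b Dv] := ker_mulmx_Re_Im x_span Bv; move/eqP: yv.
  rewrite Dv -scalemxAr -map_mxM yx map_scalar_mx scaler_eq0 => /orP [/eqP ->|].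
    by rewrite scale0r.
  by move=> /eqP/matrixP/(_ 0 0)/eqP; rewrite !mxE eqxx mulr1n fmorph_eq0 gt_eqF.
(* There are finitely many eigenvalues, so the midpoint between their largest modulus and [r] serves
   as [q]. *)
have [q q_ge0 [qr Mq]] : exists2 q, 0 <= q & q < r /\
    forall z, complex_eigenvalue M z -> normc z < q.
  have [s [s0 evs]] := @complex_eigenvalue_seq _ _ M (ltn0Sn n).
  have [z zs zmax] : exists2 z, z \in s & {in s, forall w, normc w <= normc z}.
    by case: s s0 {evs} => // a s _; apply: seq_argmax (mem_head a s).
  have zr : normc z < r by apply: M_lt; rewrite evs.
  have z_ge0 := normc_ge0 z; exists ((normc z + r) / 2); first lra.
  by split=> [|w]; [lra | rewrite evs => /zmax; lra].
have [K KM] := real_power_mx_bound Mq.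
have P_gt0 i j : 0 < P i j.
  by rewrite !mxE big_ord1 !mxE mulr_gt0 ?invr_gt0// mulr_gt0.
have /fin_all_exists [N HN] (ij : 'I_n.+1 * 'I_n.+1) : exists N, forall k, (N <= k)%N ->
    K ij.1 ij.2 * q ^+ k < P ij.1 ij.2 * r ^+ k by exact: geom_dominated.
exists (\max_ij N ij).+1%N => // -[//|k] Nk; apply/strongly_positive_mxP => i j.
have := HN (i, j) k.+1 (leq_trans (leq_bigmax (i, j)) (ltnW Nk)) => /= Kk.
rewrite DBk mxE [X in _ < _ + X]mxE mulrC.
have := KM k.+1 i j; rewrite ler_norml => /andP[].
lra.
Qed.

(** For [z = a + b i], squaring turns the inequality into [a^2 + b^2 - s^2 < 2 c (s - a)], linear in
    [c] with positive slope. *)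
Lemma normc_shift_lt (R : rcfType) (s : R) (z : R[i]) : complex.Re z < s ->
  exists c0, forall c, c0 <= c -> 0 < s + c -> normc (z + real_complex R c) < s + c.
Proof.
case: z => a b /= a_s; set m := `|a ^+ 2 + b ^+ 2 - s ^+ 2|.
have sa : 0 < 2 * (s - a) by rewrite mulr_gt0// subr_gt0.
exists ((m + 1) / (2 * (s - a))) => c; rewrite ler_pdivrMr// => mc sc.
rewrite addr0 -ltr_sqr ?nnegrE ?sqrtr_ge0 ?(ltW sc)// sqr_sqrtr ?addr_ge0 ?sqr_ge0//.
have : a ^+ 2 + b ^+ 2 - s ^+ 2 <= m by exact: ler_norm.
nra.
Qed.

Lemma dominant_shift (R : rcfType) (s : R) (l : seq R[i]) :
    {in l, forall z, z != real_complex R s -> complex.Re z < s} ->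
  exists c, 0 < s + c /\
    {in l, forall z, z != real_complex R s -> normc (z + real_complex R c) < s + c}.
Proof.
(* A threshold valid for all larger [c] is stable under induction over the list, because thresholds
   combine by maximum. *)
move=> l_lt; suff [c0 Hc] : exists c0, forall c, c0 <= c -> 0 < s + c ->
    {in l, forall z, z != real_complex R s -> normc (z + real_complex R c) < s + c}.
  (* The bound [1 - s] ensures [s + c >= 1]. *)
  exists (Num.max c0 (1 - s)).
  have sc : 0 < s + Num.max c0 (1 - s).
    by rewrite -ltrBlDl sub0r lt_max; apply/orP; right; lra.
  by split=> //; apply: Hc; rewrite // le_max lexx.
elim: l l_lt => [_|z l IHl l_lt]; first by exists 0.
have [|c0 Hl] := IHl; first by move=> w wl; apply: l_lt; rewrite inE wl orbT.
have [-> |zs] := eqVneq z (real_complex R s).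
  exists c0 => c c0c sc w; rewrite inE => /predU1P [->|]; first by rewrite eqxx.
  exact: Hl.
have [c1 Hz] := normc_shift_lt (l_lt z (mem_head _ _) zs).
exists (Num.max c0 c1) => c; rewrite ge_max => /andP [c0c c1c] sc w.
by rewrite inE => /predU1P [-> _|]; [exact: Hz | exact: Hl].
Qed.

Lemma dominant_powers_positive (R : realType) n (A : 'M[R]_n.+1) :
    spectral_bound_dominant A -> geometrically_simple A (spectral_bound A) ->
    ker_has_strongly_positive ((spectral_bound A)%:M - A) ->
    ker_has_strongly_positive ((spectral_bound A)%:M - A^T) ->
  exists c, powers_eventually_strongly_positive (A + c%:M).
Proof.
set s := spectral_bound A => -[_ s_dom] s_simple [x x_gt0] /sub_scalar_kerP Ax.
move=> [y y_gt0] /sub_scalar_kerP Ay.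
have x_span := (eigenspace_rank1P (strongly_positive_neq0 x_gt0) Ax).1 s_simple.
have [l [_ evl]] := @complex_eigenvalue_seq _ _ A (ltn0Sn n).
have [|c [sc_gt0 c_dom]] := @dominant_shift _ s l.
  move=> z; rewrite -evl => zA zs.
  rewrite lt_neqAle (spectral_bound_max A (ltn0Sn n)).2// andbT.
  by apply: contra zs => /eqP /s_dom ->.
have shift (M : 'M[R]_n.+1) (u : 'cV[R]_n.+1) :
    M *m u = s *: u <-> (M + c%:M) *m u = (s + c) *: u.
  by rewrite mulmxDl mul_scalar_mx scalerDl; split=> [->//|/addIr].
exists c; apply: (eventually_positive_of_dominant sc_gt0 x_gt0 y_gt0).
- exact/shift.
- by rewrite linearD /= tr_scalar_mx; apply/shift.
- by move=> u /shift /x_span.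
move=> z /(complex_eigenvalue_shift (- c)).
rewrite !raddfN addrK evl => zl zsc.
have := c_dom _ zl; rewrite subrK; apply.
by rewrite subr_eq -rmorphD.
Qed.

Lemma dominant_algebraically_simple (R : realType) n (A : 'M[R]_n.+1) s :
    geometrically_simple A s -> ker_has_strongly_positive (s%:M - A) ->
    ker_has_strongly_positive (s%:M - A^T) ->
  algebraically_simple A s.
Proof.
move=> s_simple [x x_gt0] /sub_scalar_kerP Ax [y y_gt0] /sub_scalar_kerP Ay.
have x_span := (eigenspace_rank1P (strongly_positive_neq0 x_gt0) Ax).1 s_simple.
rewrite /algebraically_simple -s_simple; apply/eqP.
rewrite eqn_leq (mxrankS (eigenspace_sub_geigen _ _)) andbT mxrankS//.
apply: geigenspace_sub_eigenspace x_span Ay _.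
by rewrite gt_eqF// dot_gt0.
Qed.

(** * The matrix exponential as a limit of Euler products *)

Lemma series_tail_le (R : realType) (u g : nat -> R) N m :
    (forall j, `|u j| <= g j) -> (N <= m)%N ->
  `|series u m - series u N| <= series g m - series g N.
Proof.
move=> ug Nm; rewrite !sub_series_geq// (le_trans (ler_norm_sum _ _ _))//.
exact: ler_sum.
Qed.

(** This is Tannery's theorem, dominated convergence for series. The cut at [phi k] fits Euler
    products, whose expansions are finite sums. *)
Lemma dominated_cvg_series (R : realType) (f : nat -> nat -> R) (g F : nat -> R) phi :
    (forall k j, `|f k j| <= g j) -> cvgn (series g) ->
    (forall j, f k j @[k --> \oo] --> F j) -> (forall k, (k <= phi k)%N) ->
  cvgn (series F) /\ series (f k) (phi k) @[k --> \oo] --> limn (series F).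
Proof.
move=> fg g_cvg fF k_phi.
have g_ge0 j : 0 <= g j by exact: le_trans (normr_ge0 _) (fg 0%N j).
have Fg j : `|F j| <= g j.
  by apply: cvgr_to_le (cvg_norm (fF j)) _; apply: nearW => k; apply: fg.
have F_cvg : cvgn (series F).
  by apply: normed_cvg; apply: series_le_cvg g_cvg => //= j; apply: normr_ge0.
split=> //; apply/cvgrPdist_le => e e_gt0.
have e3_gt0 : 0 < e / 3 by rewrite divr_gt0.
have g_incr : nondecreasing_seq (series g).
  by apply/nondecreasing_seqP => m; rewrite /series /= big_nat_recr//= lerDl.
(* Beyond [N] the dominating series bounds the tails of [F] and of every [f k] by [e / 3]; the first
   [N] terms converge one by one. *)
have [N _ /(_ N (leqnn N)) /= gN] := (cvgrPdist_le _ _).1 g_cvg _ e3_gt0.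
have tail (u : nat -> R) m : (forall j, `|u j| <= g j) -> (N <= m)%N ->
    `|series u m - series u N| <= e / 3.
  move=> ug Nm; apply: le_trans (series_tail_le ug Nm) _.
  apply: le_trans _ gN; apply: le_trans _ (ler_norm _).
  by rewrite lerD2r; apply: nondecreasing_cvgn_le.
have FN : `|limn (series F) - series F N| <= e / 3.
  apply: (cvgr_to_le (cvg_norm (cvgB F_cvg (cvg_cst (series F N))))).
  by exists N => // m /= Nm; apply: tail.
have fN : series (f k) N @[k --> \oo] --> series F N.
  by apply: cvg_big => [|j _]; [exact: add_continuous | exact: fF].
near=> k.
have fFk : `|series F N - series (f k) N| <= e / 3.
  by near: k; exact: (cvgrPdist_le _ _).1 fN _ e3_gt0.
have fk : `|series (f k) (phi k) - series (f k) N| <= e / 3.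
  apply: tail => //; apply: leq_trans _ (k_phi k).
  by near: k; exists N.
rewrite (_ : _ - _ = (limn (series F) - series F N) + (series F N - series (f k) N)
  - (series (f k) (phi k) - series (f k) N)); last by ring.
apply: le_trans (ler_normB _ _) _; apply: le_trans (lerD (ler_normD _ _) (lexx _)) _.
lra.
Unshelve. all: by end_near. Qed.

(** The coefficient of [X ^+ j] in [(1 + X / (k + 1)) ^+ (k + 1)], as [harmonic k] is
    [1 / (k + 1)]. *)
Definition euler_coeff (R : realType) (k j : nat) : R := 'C(k.+1, j)%:R * harmonic k ^+ j.

(** The ratio [(1 - j / (k + 1)) / (j + 1)] is at most [1 / (j + 1)] and tends to it, so the bound
    and the limit [1 / j!] both follow by induction on [j]. *)
Lemma euler_coeffS (R : realType) k j :
  euler_coeff R k j.+1 = euler_coeff R k j * (1 - j%:R * harmonic k) / j.+1%:R.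
Proof.
have j0 : j.+1%:R != 0 :> R by rewrite pnatr_eq0.
apply: (mulIf j0); rewrite divfK// /euler_coeff exprS.
have -> : 'C(k.+1, j.+1)%:R * (harmonic k * harmonic k ^+ j) * j.+1%:R =
    (j.+1 * 'C(k.+1, j.+1))%:R * harmonic k * harmonic k ^+ j :> R.
  by rewrite natrM; ring.
rewrite mul_bin_left natrM.
(* For [j > k + 1] the subtraction in [nat] truncates, but the binomial coefficient is then 0. *)
have -> : (k.+1 - j)%:R * 'C(k.+1, j)%:R = (k.+1%:R - j%:R) * 'C(k.+1, j)%:R :> R.
  have [jk|kj] := leqP j k.+1; first by rewrite natrB.
  by rewrite bin_small// !mulr0.
have h1 : k.+1%:R * harmonic k = 1 :> R by rewrite /harmonic /= mulfV// pnatr_eq0.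
transitivity ((k.+1%:R * harmonic k) * 'C(k.+1, j)%:R * harmonic k ^+ j
  - 'C(k.+1, j)%:R * harmonic k ^+ j * (j%:R * harmonic k) : R); first by ring.
by rewrite h1; ring.
Qed.

Lemma euler_coeff_ge0 (R : realType) k j : 0 <= euler_coeff R k j.
Proof. by rewrite mulr_ge0 ?exprn_ge0 ?harmonic_ge0. Qed.

Lemma euler_coeff_le (R : realType) k j : euler_coeff R k j <= j`!%:R^-1.
Proof.
elim: j => [|j IHj]; first by rewrite /euler_coeff bin0 expr0 mulr1 fact0 invr1.
rewrite euler_coeffS factS mulnC natrM invfM ler_wpM2r ?invr_ge0//.
apply: le_trans IHj; rewrite ler_piMr ?euler_coeff_ge0// gerDl oppr_le0.
by rewrite mulr_ge0 ?harmonic_ge0.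
Qed.

Lemma cvg_euler_coeff (R : realType) j :
  euler_coeff R k j @[k --> \oo] --> (j`!%:R^-1 : R).
Proof.
elim: j => [|j IHj].
  rewrite fact0 invr1 (_ : (fun k => _) = cst 1); first exact: cvg_cst.
  by apply/funext => k; rewrite /euler_coeff bin0 expr0 mulr1.
rewrite factS mulnC natrM invfM; under eq_fun do rewrite euler_coeffS.
apply: cvgMl; rewrite -[X in _ --> X]mulr1; apply: cvgM => //.
rewrite -[X in _ --> X](subr0 1); apply: cvgB; first exact: cvg_cst.
rewrite -(mulr0 j%:R); apply: cvgMr; exact: cvg_harmonic.
Qed.

Lemma mx_exp_entry_bound (R : realType) n (A : 'M[R]_n) a :
    (forall i, \sum_j `|A i j| <= a) -> forall k i j, `|(A ^+ k) i j| <= a ^+ k.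
Proof.
move=> Aa; elim=> [|k IHk] i j.
  by rewrite !expr0 mxE; case: (i == j); rewrite ?normr1 ?normr0 ?ler01.
have a_ge0 : 0 <= a by apply: le_trans (Aa i); apply: sumr_ge0.
rewrite exprS -mulmxE mxE (le_trans (ler_norm_sum _ _ _))//.
apply: (@le_trans _ _ (\sum_l `|A i l| * a ^+ k)).
  by apply: ler_sum => l _; rewrite normrM ler_wpM2l.
by rewrite -mulr_suml exprS ler_wpM2r ?exprn_ge0.
Qed.

Lemma cvg_mx_entries (R : realType) m n (S : nat -> 'M[R]_(m, n)) (L : 'M[R]_(m, n)) :
  (forall i j, S k i j @[k --> \oo] --> L i j) -> S @ \oo --> L.
Proof.
move=> SL; apply/cvg_ballP => e e_gt0.
suff : \forall k \near \oo, forall ij : 'I_m * 'I_n, ball (L ij.1 ij.2) e (S k ij.1 ij.2).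
  by apply: filterS => k Sk; split=> // i j; apply: (Sk (i, j)).
by apply: filter_forall => -[i j]; exact: (cvg_ballP _ _).1 (SL i j) e e_gt0.
Qed.

Lemma cvg_mulmx_entries (R : realType) m n p (S : nat -> 'M[R]_(m, n)) (L : 'M[R]_(m, n))
    (S' : nat -> 'M[R]_(n, p)) (L' : 'M[R]_(n, p)) :
    (forall i j, S k i j @[k --> \oo] --> L i j) ->
    (forall i j, S' k i j @[k --> \oo] --> L' i j) ->
  forall i j, (S k *m S' k) i j @[k --> \oo] --> (L *m L') i j.
Proof.
move=> SL SL' i j; rewrite mxE; under eq_fun do rewrite mxE.
by apply: cvg_big => [|l _]; [exact: add_continuous | exact: cvgM].
Qed.

Lemma cvg_exp_mx_entries (R : realType) n (S : nat -> 'M[R]_n) (L : 'M[R]_n) k :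
    (forall i j, S m i j @[m --> \oo] --> L i j) ->
  forall i j, (S m ^+ k) i j @[m --> \oo] --> (L ^+ k) i j.
Proof.
move=> SL; elim: k => [|k IHk] i j; first by apply: cvg_cst.
rewrite exprS; under eq_fun do rewrite exprS.
exact: cvg_mulmx_entries.
Qed.

Definition exp_entry (R : realType) n (A : 'M[R]_n) i j (k : nat) : R :=
  k`!%:R^-1 * (A ^+ k) i j.

Lemma expm_entryE (R : realType) n (A : 'M[R]_n) :
    (forall i j, cvgn (series (exp_entry A i j))) ->
  forall i j, expm A i j = limn (series (exp_entry A i j)).
Proof.
move=> A_cvg i j.
suff -> : expm A = \matrix_(i, j) limn (series (exp_entry A i j)) by rewrite mxE.
apply: cvg_lim; first exact: norm_hausdorff.
apply: cvg_mx_entries => k l; rewrite mxE.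
rewrite (_ : (fun m => _) = series (exp_entry A k l)); first exact: A_cvg.
by apply/funext => m; rewrite /series /= summxE; apply: eq_bigr => p _; rewrite mxE.
Qed.

Definition euler_mx (R : realType) n (X : 'M[R]_n) (k : nat) : 'M[R]_n :=
  (1 + harmonic k *: X) ^+ k.+1.

Lemma euler_mx_entry (R : realType) n (X : 'M[R]_n.+1) k i j :
  euler_mx X k i j = series (fun m => euler_coeff R k m * (X ^+ m) i j) k.+2.
Proof.
rewrite /euler_mx exprDn_comm; last exact/commr_sym/commr1.
rewrite /series /= big_mkord summxE; apply: eq_bigr => m _.
by rewrite expr1n mul1r exprZn -scaler_nat scalerA mxE.
Qed.

(** The vanishing perturbation [Y] absorbs the second-order term when two Euler factors are
    multiplied: [(1 + h d) (1 + h A) = 1 + h (A + d + h d A)]. *)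
Lemma euler_mx_cvg (R : realType) n (L Y : 'M[R]_n.+1) i j :
  cvgn (series (exp_entry L i j)) /\
  euler_mx (L + harmonic k *: Y) k i j @[k --> \oo] --> limn (series (exp_entry L i j)).
Proof.
(* [a] bounds the row sums of every [X k] because [harmonic k <= 1], so the exponential series of
   [a] dominates. *)
pose a := \sum_p \sum_q (`|L p q| + `|Y p q|).
pose X k : 'M[R]_n.+1 := L + harmonic k *: Y.
have Xa k p : \sum_q `|X k p q| <= a.
  rewrite /a [leRHS](bigD1 p)//= -[leLHS]addr0 lerD//; last first.
    by apply: sumr_ge0 => q _; apply: sumr_ge0 => l _; rewrite addr_ge0.
  apply: ler_sum => q _; rewrite !mxE (le_trans (ler_normD _ _))// lerD2l normrM.
  by rewrite ler_piMl// ger0_norm ?harmonic_ge0// /harmonic /= invf_le1// ler1n.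
have X_cvg p q : X k p q @[k --> \oo] --> L p q.
  rewrite -[X in _ --> X]addr0; under eq_fun do rewrite /X mxE [X in _ + X]mxE.
  apply: cvgD; first exact: cvg_cst.
  by rewrite -(mul0r (Y p q)); apply: cvgMl; exact: cvg_harmonic.
rewrite (_ : (fun k => _) = fun k =>
    series (fun m => euler_coeff R k m * (X k ^+ m) i j) k.+2); last first.
  by apply/funext => k; rewrite euler_mx_entry.
apply: (@dominated_cvg_series R _ (exp_coeff a)).
- move=> k m; rewrite /exp_coeff /= mulrC normrM (ger0_norm (euler_coeff_ge0 R k m)).
  by rewrite ler_pM ?euler_coeff_ge0 ?euler_coeff_le//; exact: mx_exp_entry_bound.
- exact: is_cvg_series_exp_coeff.
- by move=> m; apply: cvgM; [exact: cvg_euler_coeff | exact: cvg_exp_mx_entries].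
- by move=> k; rewrite ltnW.
Qed.

Lemma is_cvg_exp_entry (R : realType) n (A : 'M[R]_n.+1) i j :
  cvgn (series (exp_entry A i j)).
Proof. exact: (@euler_mx_cvg R n A 0 i j).1. Qed.

Lemma euler_mx_cvg_expm (R : realType) n (L Y : 'M[R]_n.+1) i j :
  euler_mx (L + harmonic k *: Y) k i j @[k --> \oo] --> expm L i j.
Proof.
rewrite expm_entryE; last exact: is_cvg_exp_entry.
exact: proj2 (@euler_mx_cvg R n L Y i j).
Qed.

(** * Positivity carried between the semigroup and the powers *)

Lemma cvg_entries_gt0 (R : realType) n (S : nat -> 'M[R]_n) (L : 'M[R]_n) :
    (forall i j, S k i j @[k --> \oo] --> L i j) -> strongly_positive_mx L ->
  \forall k \near \oo, strongly_positive_mx (S k).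
Proof.
move=> SL /strongly_positive_mxP L_gt0.
suff : \forall k \near \oo, forall ij : 'I_n * 'I_n, 0 < S k ij.1 ij.2.
  by apply: filterS => k Sk; apply/strongly_positive_mxP => i j; apply: (Sk (i, j)).
by apply: filter_forall => -[i j]; apply: cvgr_gt (SL i j) _ (L_gt0 i j).
Qed.

Lemma strongly_positive_mulmx (R : realType) n (S T : 'M[R]_n.+1) :
  strongly_positive_mx S -> strongly_positive_mx T -> strongly_positive_mx (S *m T).
Proof.
move=> S_gt0 T_gt0 x x_ge0 x0; rewrite -mulmxA; have Tx := T_gt0 x x_ge0 x0.
apply: S_gt0 => [i|]; first by rewrite ltW.
exact: strongly_positive_neq0.
Qed.

Lemma strongly_positive_exp (R : realType) n (T : 'M[R]_n.+1) k :
  strongly_positive_mx T -> strongly_positive_mx (T ^+ k.+1).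
Proof.
move=> T_gt0; elim: k => [|k IHk]; first by rewrite expr1.
by rewrite exprS; apply: strongly_positive_mulmx.
Qed.

(* Every [k >= m ^ 2] is a combination [a m + b (m + 1)] with [a >= 1]. *)
Lemma consecutive_powers_positive (R : realType) n (T : 'M[R]_n.+1) m : (0 < m)%N ->
    strongly_positive_mx (T ^+ m) -> strongly_positive_mx (T ^+ m.+1) ->
  powers_eventually_strongly_positive T.
Proof.
move=> m_gt0 Tm TSm; exists (m * m)%N => [|k mk]; first by rewrite muln_gt0 m_gt0.
have r_lt := ltn_pmod k m_gt0.
have q_ge : (m <= k %/ m)%N by rewrite leq_divRL.
have Dk : k = (m * (k %/ m - k %% m) + m.+1 * (k %% m))%N.
  rewrite [in LHS](divn_eq k m) mulSn addnCA -mulnDr.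
  by rewrite subnK 1?addnC 1?mulnC// ltnW// (leq_trans r_lt).
rewrite Dk exprD !exprM.
have : (0 < k %/ m - k %% m)%N by rewrite subn_gt0 (leq_trans r_lt).
case: (_ - _)%N => // p _; case: (k %% m)%N => [|b].
  by rewrite expr0 mulr1; apply: strongly_positive_exp.
by apply: strongly_positive_mulmx; apply: strongly_positive_exp.
Qed.

Lemma semigroup_positive_powers (R : realType) n (A : 'M[R]_n.+1) :
  semigroup_eventually_strongly_positive A ->
  exists c, powers_eventually_strongly_positive (A + c%:M).
Proof.
move=> [t0 t0_ge0 /(_ (t0 + 1))]; rewrite lerDl ler01 => /(_ isT).
have t_gt0 : 0 < t0 + 1 by rewrite ltr_wpDl.
move: (t0 + 1) t_gt0 => {t0 t0_ge0} t t_gt0; set L := t *: A => E_gt0.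
have L_cvg i j : euler_mx L k i j @[k --> \oo] --> expm L i j.
  have := @euler_mx_cvg_expm R n L 0 i j.
  by under eq_fun do rewrite scaler0 addr0.
pose Q k : 'M[R]_n.+1 := 1 + harmonic k *: L.
have Q_cvg i j : Q k i j @[k --> \oo] --> (1 : 'M[R]_n.+1) i j.
  rewrite -[X in _ --> X]addr0; under eq_fun do rewrite /Q mxE [X in _ + X]mxE.
  apply: cvgD; first exact: cvg_cst.
  by rewrite -(mul0r (L i j)); apply: cvgMl; exact: cvg_harmonic.
(* One further factor [Q k] leaves the limit unchanged since [Q k] tends to 1; this gives two
   consecutive powers with a positive limit. *)
have LQ_cvg i j : (euler_mx L k *m Q k) i j @[k --> \oo] --> expm L i j.
  by rewrite -[expm L]mulmx1; exact: cvg_mulmx_entries.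
have /filter_ex [k [Qk QSk]] : \forall k \near \oo,
    strongly_positive_mx (euler_mx L k) /\ strongly_positive_mx (euler_mx L k *m Q k).
  by apply: filterI; [exact: cvg_entries_gt0 L_cvg _ | exact: cvg_entries_gt0 LQ_cvg _].
have ht_gt0 : 0 < harmonic k * t by rewrite mulr_gt0 ?harmonic_gt0.
(* With [h = harmonic k], the matrix [A + 1 / (h t)] is the positive multiple [1 / (h t)] of
   [Q k = 1 + h t A]. *)
exists (harmonic k * t)^-1.
have -> : A + (harmonic k * t)^-1%:M = (harmonic k * t)^-1 *: Q k.
  rewrite scalerDr !scalerA -mulrA mulVf ?gt_eqF// scale1r addrC.
  by rewrite -[1]/(1%:M) scale_scalar_mx mulr1.
have QSk' : strongly_positive_mx (Q k ^+ k.+2) by rewrite exprSr.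
have [k0 k0_gt0 Qpos] := consecutive_powers_positive (ltn0Sn k) Qk QSk'.
exists k0 => // m /Qpos/strongly_positive_mxP Qm; apply/strongly_positive_mxP => i j.
by rewrite exprZn mxE mulr_gt0// exprn_gt0// invr_gt0.
Qed.

(* [(I + h A)^k (1 + h d)^k] tends to [e^(A + d I)], where [h = 1 / k]; nothing
   but nonnegativity of the limit of the scalar factor is needed. *)
Lemma expm_gt0_of_shift (R : realType) n (A : 'M[R]_n.+1) d i j :
  0 < expm (A + d%:M) i j -> 0 < expm A i j.
Proof.
(* [l] is the scalar exponential of [d], taken as a 1 by 1 matrix so that the Euler limit applies to
   it. *)
set l := expm (d%:M : 'M[R]_1) 0 0.
have s_cvg : (1 + harmonic k * d) ^+ k.+1 @[k --> \oo] --> l.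
  have := @euler_mx_cvg_expm R 0 d%:M 0 0 0; apply: cvg_trans; apply: near_eq_cvg.
  apply: nearW => k; rewrite /euler_mx scaler0 addr0 scale_scalar_mx.
  rewrite -[1]/(1%:M) -raddfD -[_%:M ^+ _](rmorphXn (@scalar_mx R 1)).
  by rewrite mxE eqxx mulr1n.
have l_ge0 : 0 <= l.
  apply: cvgr_to_ge s_cvg _.
  have h_cvg : 1 + harmonic k * d @[k --> \oo] --> (1 : R).
    rewrite -[X in _ --> X]addr0; apply: cvgD; first exact: cvg_cst.
    by rewrite -(mul0r d); apply: cvgMl; exact: cvg_harmonic.
  have /cvgr_gt/(_ 0 ltr01) := h_cvg.
  by apply: filterS => k hk; rewrite exprn_ge0// ltW.
have A_cvg := @euler_mx_cvg_expm R n A 0 i j.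
have Ad_cvg := @euler_mx_cvg_expm R n (A + d%:M) (d *: A) i j.
have D k : (1 + harmonic k * d) ^+ k.+1 * euler_mx (A + harmonic k *: 0) k i j =
    euler_mx (A + d%:M + harmonic k *: (d *: A)) k i j.
  rewrite /euler_mx scaler0 addr0.
  have -> : 1 + harmonic k *: (A + d%:M + harmonic k *: (d *: A)) =
      (1 + harmonic k * d) *: (1 + harmonic k *: A).
    rewrite scalerDl scale1r !scalerDr !scalerA -!addrA; congr (_ + (_ + (_ + _))).
      by rewrite -[1]/(1%:M) !scale_scalar_mx mulr1.
    by congr (_ *: _); ring.
  by rewrite exprZn mxE.
have -> : expm (A + d%:M) i j = l * expm A i j.
  rewrite -(cvg_lim (@Rhausdorff R) Ad_cvg); apply: cvg_lim; first exact: Rhausdorff.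
  by under eq_fun do rewrite -D; exact: cvgM.
by move: l_ge0; rewrite le_eqVlt => /predU1P [<-|/pmulr_rgt0->]//; rewrite mul0r ltxx.
Qed.

(** For [t >= 1] the terms up to [k0] sum to at least [- C t ^+ k0], the next one is
    [t ^+ k0 * (t * b k0.+1)], and all later ones are positive. *)
Lemma expm_scale_entry_gt0 (R : realType) n (B : 'M[R]_n.+1) k0 i j :
    (forall k, (k0 < k)%N -> 0 < (B ^+ k) i j) ->
  exists2 t0, 0 <= t0 & forall t, t0 <= t -> 0 < expm (t *: B) i j.
Proof.
move=> B_gt0; pose b k := k`!%:R^-1 * (B ^+ k) i j.
have b_gt0 k : (k0 < k)%N -> 0 < b k.
  by move=> /B_gt0 Bk; rewrite mulr_gt0// invr_gt0 ltr0n fact_gt0.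
pose C : R := \sum_(0 <= k < k0.+1) `|b k|.
have C_ge0 : 0 <= C by apply: sumr_ge0.
have beta_gt0 := b_gt0 k0.+1 (ltnSn k0).
(* The summand 1 gives both [t >= 1] and the strict inequality [t * b k0.+1 > C]. *)
exists (1 + C / b k0.+1) => [|t t_ge]; first by rewrite addr_ge0// divr_ge0// ltW.
have t_ge1 : 1 <= t by apply: le_trans t_ge; rewrite lerDl divr_ge0// ltW.
have t_gt0 : 0 < t by apply: lt_le_trans t_ge1.
have d_gt0 : 0 < t * b k0.+1 - C.
  rewrite subr_gt0 -ltr_pdivrMr//; apply: lt_le_trans t_ge.
  by rewrite ltrDr.
rewrite expm_entryE; last exact: is_cvg_exp_entry.
apply: (@lt_le_trans _ _ (t ^+ k0 * (t * b k0.+1 - C))).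
  by rewrite mulr_gt0// exprn_gt0.
apply: limr_ge; first exact: is_cvg_exp_entry.
exists k0.+2 => // m /= km.
have -> : series (exp_entry (t *: B) i j) m = \sum_(0 <= k < m) t ^+ k * b k.
  by apply: eq_bigr => k _; rewrite /exp_entry exprZn mxE /b mulrCA.
rewrite (big_cat_nat (leq0n k0.+1) (ltnW km)) /= (big_ltn km).
rewrite mulrBr mulrA -exprSr addrA [leLHS]addrC -[leLHS]addr0; apply: lerD; last first.
  rewrite big_seq; apply: sumr_ge0 => k; rewrite mem_index_iota => /andP [kk _].
  by rewrite mulr_ge0 ?exprn_ge0 ?(ltW t_gt0)// ltW// b_gt0// ltnW.
rewrite lerD2r /C mulr_sumr -sumrN big_seq [leRHS]big_seq; apply: ler_sum => k.
rewrite mem_index_iota => /andP [_ kk].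
have tk : t ^+ k <= t ^+ k0 by rewrite ler_weXn2l.
rewrite lerNl -mulrN; apply: le_trans (_ : t ^+ k * `|b k| <= _).
  by rewrite ler_wpM2l ?exprn_ge0 ?(ltW t_gt0)// ler_normr lexx orbT.
by rewrite ler_wpM2r.
Qed.

Lemma powers_positive_semigroup (R : realType) n (A : 'M[R]_n.+1) c :
  powers_eventually_strongly_positive (A + c%:M) ->
  semigroup_eventually_strongly_positive A.
Proof.
move=> [k0 _ B_gt0].
have entry (ij : 'I_n.+1 * 'I_n.+1) : exists t0, 0 <= t0 /\
    forall t, t0 <= t -> 0 < expm (t *: (A + c%:M)) ij.1 ij.2.
  have [|t0 t0_ge0 Ht] := @expm_scale_entry_gt0 _ _ (A + c%:M) k0 ij.1 ij.2.
    by move=> k /ltnW /B_gt0 /strongly_positive_mxP.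
  by exists t0.
have [T HT] := fin_all_exists entry.
(* The entrywise thresholds are nonnegative, so their sum bounds each of them. *)
exists (\sum_ij T ij) => [|t t_ge]; first by apply: sumr_ge0 => ij _; case: (HT ij).
apply/strongly_positive_mxP => i j; apply: (@expm_gt0_of_shift _ _ _ (t * c)).
rewrite -scale_scalar_mx -scalerDr; apply: (HT (i, j)).2; apply: le_trans t_ge.
by rewrite (bigD1 (i, j))//= lerDl; apply: sumr_ge0 => ij _; case: (HT ij).
Qed.

Theorem theorem6p1 (R : realType) (n : nat) (n_ge1 : (1 <= n)%N)
    (A : 'M[R]_n) :
  let s := spectral_bound A in
  let assertion_i := semigroup_eventually_strongly_positive A in
  let assertion_ii :=
    [/\ spectral_bound_dominant A,
        geometrically_simple A s,
        ker_has_strongly_positive (s%:M - A) &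
        ker_has_strongly_positive (s%:M - A^T)] in
  let assertion_iii :=
    exists c : R, powers_eventually_strongly_positive (A + c%:M) in
  [/\ assertion_i <-> assertion_ii,
      assertion_ii <-> assertion_iii &
      assertion_i -> algebraically_simple A s].
Proof.
case: n n_ge1 A => // n _ A s assertion_i assertion_ii assertion_iii.
have i_iii : assertion_i -> assertion_iii by exact: semigroup_positive_powers.
have iii_i : assertion_iii -> assertion_i by move=> [c]; exact: powers_positive_semigroup.
have iii_ii : assertion_iii -> assertion_ii by move=> [c]; exact: powers_positive_dominant.
have ii_iii : assertion_ii -> assertion_iii.
  by move=> [dom simple kx ky]; exact: dominant_powers_positive.
split; [by split=> [/i_iii | /ii_iii] | by [] | move=> /i_iii/iii_ii].
by move=> [_ simple kx ky]; exact: dominant_algebraically_simple.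
Qed.
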